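(* Let $m\ge 1$, let $\|\cdot\|$ be a norm on $\mathbf{R}^m$, and let $\boldsymbol F:\mathbf{R}^m\to\mathbf{R}^m$ be a map respecting equality of real vectors, with the origin as equilibrium ($\boldsymbol F(0)=_r 0$). Assume there exist a function $V:\mathbf{R}^m\to\mathbf{R}$ and two class-$\mathcal{K}_<$ functions $\kappa_1,\kappa_2$ such that $$\kappa_1(\|\boldsymbol x\|)\le_r V(\boldsymbol x)\le_r\kappa_2(\|\boldsymbol x\|)\quad\text{for all }\boldsymbol x\in\mathbf{R}^m,$$ $$V(\boldsymbol x(n+1))\le_r V(\boldsymbol x(n))\quad\text{for all } n\ge 0$$ for any solution $(\boldsymbol x(n))_n$ of $\boldsymbol x^+=\boldsymbol F(\boldsymbol x)$, $\boldsymbol x(0)=\boldsymbol x_0$. Then the equilibrium is stable in the following sense: for any real $\varepsilon>0$ there exists a real $\delta>0$ such that, for every solution $(\boldsymbol x(n))_n$, $\exists p\;\|\boldsymbol x(0)\|<_p\delta$ implies that for all $n\ge 0$, $\exists p\;\|\boldsymbol x(n)\|<_p\varepsilon$.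
   Context: The result is stated in constructive analysis (BHK interpretation). A real number $x=((a_n)_n,M)$ is a sequence of rationals with a monotone modulus $M$ from positive integers to natural numbers such that $|a_n-a_{n'}|\le 2^{-p}$ whenever $M(p)\le n,n'$. For reals $x=((a_n),M)$, $y=((b_n),N)$: $x=_r y$ means $|a_{M(p+1)}-b_{N(p+1)}|\le 2^{-p}$ for all positive integers $p$; $0\le_r x$ means $0\le a_{M(p)}+2^{-p}$ for all $p$, and $x\le_r y$ means $0\le_r y-x$; $x\in_p\mathbf{R}^+$ means $2^{-p}\le a_{M(p+1)}$, and $x<_p y$ means $y-x\in_p\mathbf{R}^+$. Strict inequality $x<y$ means $\exists p\; x<_p y$ (constructive existence); in particular $\varepsilon>0$ means $\exists p\;0<_p\varepsilon$. $\mathbf{R}^m$ is the set of vectors of $m$ reals with componentwise equality. A solution of $\boldsymbol x^+=\boldsymbol F(\boldsymbol x)$, $\boldsymbol x(0)=\boldsymbol x_0$ is a sequence $(\boldsymbol x(n))_n$ in $\mathbf{R}^m$ with $\boldsymbol x(0)=_r\boldsymbol x_0$ and $\boldsymbol x(n+1)=_r\boldsymbol F(\boldsymbol x(n))$ for all $n$. A globally continuous function $\kappa$ is given by $h:\mathbb{Q}\times\mathbb{N}\to\mathbb{Q}$ together with, for all rational intervals $[c,d]$, monotone maps $\alpha_{c,d}$ (positive integers to naturals) and $\omega_{c,d}$ (positive integers to positive integers) such that for all rationals $a,b\in[c,d]$: $(h(a,n))_n$ is Cauchy with modulus $\alpha_{c,d}$, and $|a-b|\le 2^{-\omega_{c,d}(p)+1}$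 implies $|h(a,n)-h(b,n)|\le 2^{-p}$. Its value at a real $x=((a_n),M)$ lying in $[c,d]$ is the real $\kappa(x)$ given by the sequence $(h(a_n,n))_n$ with modulus $p\mapsto\max(\alpha_{c,d}(p+2),M(\omega_{c,d}(p+1)-1))$. A globally continuous $\kappa$ is of class-$\mathcal{K}$ if, for all reals $x,y$: (i) $x=_r0\Rightarrow\kappa(x)=_r0$; (ii) $0\le_r x$, $0\le_r y$, $x\le_r y$ imply $\kappa(x)\le_r\kappa(y)$; (iii) $0\le_r x$, $0\le_r y$, $\kappa(x)\le_r\kappa(y)$ imply $x\le_r y$; (iv) $0<x\Rightarrow 0<\kappa(x)$. It is of class-$\mathcal{K}_<$ if in addition, for all reals $x,y$ with $0\le_r x$ and $0\le_r y$: $x<y\Rightarrow\kappa(x)<\kappa(y)$ and $\kappa(x)<\kappa(y)\Rightarrow x<y$. *)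

(* Defs.v *)
From Stdlib Require Export QArith Qabs Qpower PArith.
From Stdlib Require Import Arith Lia Lqa.
From Stdlib Require Fin.

Open Scope Q_scope.

(** Statements whose constructive proofs carry no computational content are
    propositions, while existence of a witness (as in [x < y]) is a sigma
    type, so that hypotheses supply, and conclusions must produce, actual
    witnesses. *)

Definition pow2 (z : Z) : Q := 2 ^ z.

Definition monotone_nat (M : positive -> nat) : Prop :=
  forall p q : positive, (p <= q)%positive -> (M p <= M q)%nat.

Definition monotone_pos (w : positive -> positive) : Prop :=
  forall p q : positive, (p <= q)%positive -> (w p <= w q)%positive.

Definition cauchy_mod (a : nat -> Q) (M : positive -> nat) : Prop :=
  forall (p : positive) (n n' : nat),
    (M p <= n)%nat -> (M p <= n')%nat ->
    Qabs (a n - a n') <= pow2 (- Zpos p).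

Record real : Set := mk_real {
  sq : nat -> Q;
  md : positive -> nat;
  md_mono : monotone_nat md;
  sq_cauchy : cauchy_mod sq md
}.

Lemma pow2_pos z : 0 < pow2 z.
Proof. apply Qpower_0_lt; reflexivity. Qed.

Lemma pow2_plus u v : pow2 (u + v) == pow2 u * pow2 v.
Proof. apply Qpower_plus; discriminate. Qed.

Lemma pow2_half z : pow2 (z - 1) == (1 # 2) * pow2 z.
Proof.
unfold Z.sub; rewrite pow2_plus, Qmult_comm.
apply Qmult_comp; reflexivity.
Qed.

Lemma pow2_opp_succ p : pow2 (- Zpos (p + 1)) == (1 # 2) * pow2 (- Zpos p).
Proof.
rewrite <- pow2_half.
replace (- Zpos (p + 1))%Z with (- Zpos p - 1)%Z by lia; reflexivity.
Qed.

Lemma pow2_le u v : (u <= v)%Z -> pow2 u <= pow2 v.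
Proof. intro H; apply Qpower_le_compat_l; [exact H | discriminate]. Qed.

Lemma Qabs_tri a b c : Qabs (a - c) <= Qabs (a - b) + Qabs (b - c).
Proof.
setoid_replace (a - c) with ((a - b) + (b - c)) by ring.
apply Qabs_triangle.
Qed.

(** ** Equality and order *)

Definition req (x y : real) : Prop :=
  forall p : positive,
    Qabs (sq x (md x (p + 1)%positive) - sq y (md y (p + 1)%positive))
      <= pow2 (- Zpos p).

Definition rnonneg (x : real) : Prop :=
  forall p : positive, 0 <= sq x (md x p) + pow2 (- Zpos p).

Definition rpos_at (p : positive) (x : real) : Prop :=
  pow2 (- Zpos p) <= sq x (md x (p + 1)%positive).

(** ** Arithmetic *)

Program Definition rconst (q : Q) : real := mk_real (fun _ => q) (fun _ => 0%nat) _ _.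
Next Obligation. intros p q' _; apply le_n. Qed.
Next Obligation.
intros p n n' _ _; setoid_replace (q - q) with 0 by ring.
apply Qlt_le_weak, pow2_pos.
Qed.

Definition rzero : real := rconst 0.

Program Definition ropp (x : real) : real := mk_real (fun n => - sq x n) (md x) _ _.
Next Obligation. apply md_mono. Qed.
Next Obligation.
intros p n n' Hn Hn'.
setoid_replace (- sq x n - - sq x n') with (- (sq x n - sq x n')) by ring.
rewrite Qabs_opp; apply sq_cauchy; assumption.
Qed.

Program Definition rplus (x y : real) : real :=
  mk_real (fun n => sq x n + sq y n)
          (fun p => Nat.max (md x (p + 1)%positive) (md y (p + 1)%positive)) _ _.
Next Obligation.
intros p q Hpq.
pose proof (md_mono x (p + 1)%positive (q + 1)%positive ltac:(lia)).
pose proof (md_mono y (p + 1)%positive (q + 1)%positive ltac:(lia)); lia.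
Qed.
Next Obligation.
intros p n n' Hn Hn'.
setoid_replace (sq x n + sq y n - (sq x n' + sq y n'))
  with ((sq x n - sq x n') + (sq y n - sq y n')) by ring.
pose proof (sq_cauchy x (p + 1)%positive n n' ltac:(lia) ltac:(lia)) as Hx.
pose proof (sq_cauchy y (p + 1)%positive n n' ltac:(lia) ltac:(lia)) as Hy.
pose proof (Qabs_triangle (sq x n - sq x n') (sq y n - sq y n')).
rewrite pow2_opp_succ in Hx, Hy; lra.
Qed.

Definition rminus (x y : real) : real := rplus x (ropp y).

Program Definition rabs (x : real) : real := mk_real (fun n => Qabs (sq x n)) (md x) _ _.
Next Obligation. apply md_mono. Qed.
Next Obligation.
intros p n n' Hn Hn'.
apply Qle_trans with (Qabs (sq x n - sq x n')).
- apply Qabs_Qle_condition; split.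
  + pose proof (Qabs_triangle_reverse (sq x n') (sq x n)).
    rewrite (Qabs_Qminus (sq x n') (sq x n)) in H; lra.
  + apply Qabs_triangle_reverse.
- apply sq_cauchy; assumption.
Qed.

Fixpoint abs_sum (a : nat -> Q) (n : nat) : Q :=
  match n with
  | O => Qabs (a O)
  | S k => abs_sum a k + Qabs (a (S k))
  end.

(** [bexp x] is an exponent with [|a_n| <= 2 ^ bexp x] for every [n]. *)
Definition bexp (x : real) : positive :=
  proj1_sig (Qarchimedean_power2_pos (abs_sum (sq x) (md x 1%positive) + 1)).

Lemma abs_sum_ge a n k : (k <= n)%nat -> Qabs (a k) <= abs_sum a n.
Proof.
revert k; induction n as [|n IH]; intros k Hk; simpl.
- replace k with 0%nat by lia; apply Qle_refl.
- destruct (Nat.eq_dec k (S n)) as [->|Hne].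
  + pose proof (IH 0%nat ltac:(lia)); pose proof (Qabs_nonneg (a 0%nat)); lra.
  + pose proof (IH k ltac:(lia)); pose proof (Qabs_nonneg (a (S n))); lra.
Qed.

Lemma pow2_Zpos p : pow2 (Zpos p) == (Z.pos (2 ^ p) # 1).
Proof.
change (Z.pos (2 ^ p) # 1) with (inject_Z (Z.pos (2 ^ p))).
rewrite Pos2Z.inj_pow, Zpower_Qpower by discriminate; reflexivity.
Qed.

Lemma bexp_bound x n : Qabs (sq x n) <= pow2 (Zpos (bexp x)).
Proof.
unfold bexp; destruct (Qarchimedean_power2_pos _) as [p Hp]; simpl.
apply Qle_trans with (abs_sum (sq x) (md x 1) + 1);
  [|rewrite (pow2_Zpos p); apply Qlt_le_weak, Hp].
destruct (Nat.le_ge_cases n (md x 1)) as [H|H].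
- pose proof (abs_sum_ge (sq x) _ _ H); lra.
- pose proof (abs_sum_ge (sq x) _ _ (le_n (md x 1))).
  pose proof (sq_cauchy x 1%positive n (md x 1) H (le_n _)) as H1.
  change (pow2 (- Zpos 1)) with (1 # 2) in H1.
  pose proof (Qabs_triangle_reverse (sq x n) (sq x (md x 1))); lra.
Qed.

Program Definition rmult (x y : real) : real :=
  mk_real (fun n => sq x n * sq y n)
          (fun p => Nat.max (md x (p + 1 + bexp y)%positive)
                            (md y (p + 1 + bexp x)%positive)) _ _.
Next Obligation.
intros p q Hpq.
pose proof (md_mono x (p + 1 + bexp y)%positive (q + 1 + bexp y)%positive ltac:(lia)).
pose proof (md_mono y (p + 1 + bexp x)%positive (q + 1 + bexp x)%positive ltac:(lia)); lia.
Qed.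
Next Obligation.
assert (E : forall p b : positive,
  pow2 (Zpos b) * pow2 (- Zpos (p + 1 + b)) == (1 # 2) * pow2 (- Zpos p)).
{ intros p b; rewrite <- pow2_plus, <- pow2_half.
  replace (Zpos b + - Zpos (p + 1 + b))%Z with (- Zpos p - 1)%Z by lia; reflexivity. }
assert (P : forall u v B e, Qabs u <= B -> Qabs v <= e -> Qabs (u * v) <= B * e).
{ intros u v B e Hu Hv; rewrite Qabs_Qmult.
  apply Qmult_le_compat_nonneg; split; try assumption; apply Qabs_nonneg. }
intros p n n' Hn Hn'.
setoid_replace (sq x n * sq y n - sq x n' * sq y n')
  with (sq x n * (sq y n - sq y n') + sq y n' * (sq x n - sq x n')) by ring.
pose proof (P _ _ _ _ (bexp_bound x n)
  (sq_cauchy y (p + 1 + bexp x)%positive n n' ltac:(lia) ltac:(lia))) as H1.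
pose proof (P _ _ _ _ (bexp_bound y n')
  (sq_cauchy x (p + 1 + bexp y)%positive n n' ltac:(lia) ltac:(lia))) as H2.
rewrite E in H1, H2.
eapply Qle_trans; [apply Qabs_triangle|]; lra.
Qed.

Definition rle (x y : real) : Prop := rnonneg (rminus y x).

Definition rlt_at (p : positive) (x y : real) : Prop := rpos_at p (rminus y x).

Definition rlt (x y : real) : Set := {p : positive | rlt_at p x y}.

Declare Scope creal_scope.
Delimit Scope creal_scope with creal.
Bind Scope creal_scope with real.
Notation "x =r y" := (req x y) (at level 70, no associativity) : creal_scope.
Notation "x <=r y" := (rle x y) (at level 70, no associativity) : creal_scope.
Notation "x <r y" := (rlt x y) (at level 70, no associativity) : creal_scope.
Open Scope creal_scope.

(** ** Vectors *)

Definition vec (m : nat) : Set := Fin.t m -> real.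

Definition veq {m : nat} (x y : vec m) : Prop := forall i, x i =r y i.
Definition vzero {m : nat} : vec m := fun _ => rzero.
Definition vplus {m : nat} (x y : vec m) : vec m := fun i => rplus (x i) (y i).
Definition vscal {m : nat} (c : real) (x : vec m) : vec m := fun i => rmult c (x i).

Notation "x =v y" := (veq x y) (at level 70, no associativity) : creal_scope.

Record is_norm {m : nat} (N : vec m -> real) : Prop := {
  norm_ext : forall x y, x =v y -> N x =r N y;
  norm_nonneg : forall x, rzero <=r N x;
  norm_definite : forall x, N x =r rzero <-> x =v vzero;
  norm_homogeneous : forall c x, N (vscal c x) =r rmult (rabs c) (N x);
  norm_triangle : forall x y, N (vplus x y) <=r rplus (N x) (N y)
}.

Record is_solution {m : nat} (F : vec m -> vec m) (x0 : vec m) (x : nat -> vec m)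
    : Prop := {
  solution_init : x 0%nat =v x0;
  solution_step : forall n, x (S n) =v F (x n)
}.

(** ** Globally continuous functions *)

Definition in_itv (c d a : Q) : Prop := c <= a /\ a <= d.

Record gcont : Set := mk_gcont {
  gh : Q -> nat -> Q;
  galpha : Q -> Q -> positive -> nat;
  gomega : Q -> Q -> positive -> positive;
  galpha_mono : forall c d, c <= d -> monotone_nat (galpha c d);
  gomega_mono : forall c d, c <= d -> monotone_pos (gomega c d);
  gh_cauchy : forall c d a, in_itv c d a -> cauchy_mod (gh a) (galpha c d);
  gh_cont : forall c d a b (p : positive) (n : nat),
    in_itv c d a -> in_itv c d b ->
    Qabs (a - b) <= pow2 (- Zpos (gomega c d p) + 1) ->
    Qabs (gh a n - gh b n) <= pow2 (- Zpos p)
}.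

(** [x] lies in [[c, d]] in the sense that all its approximations do, so that
    [galpha c d] and [gomega c d] apply to them. *)
Definition real_in (c d : Q) (x : real) : Prop := forall n, in_itv c d (sq x n).

(** When [gomega c d (p + 1)] is [1] its predecessor is not a positive integer;
    [Pos.pred 1 = 1] then still gives a modulus. *)
Program Definition gval_on (k : gcont) (c d : Q) (x : real) (Hx : real_in c d x)
    : real :=
  mk_real (fun n => gh k (sq x n) n)
          (fun p => Nat.max (galpha k c d (p + 2)%positive)
                            (md x (Pos.pred (gomega k c d (p + 1)%positive)))) _ _.
Next Obligation.
assert (Hcd : c <= d) by (destruct (Hx 0%nat); lra).
intros p q Hpq.
pose proof (galpha_mono k c d Hcd (p + 2)%positive (q + 2)%positive ltac:(lia)).
pose proof (gomega_mono k c d Hcd (p + 1)%positive (q + 1)%positive ltac:(lia)).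
pose proof (md_mono x (Pos.pred (gomega k c d (p + 1)%positive))
  (Pos.pred (gomega k c d (q + 1)%positive)) ltac:(lia)).
lia.
Qed.
Next Obligation.
intros p n n' Hn Hn'.
pose proof (gh_cauchy k c d _ (Hx n) (p + 2)%positive n n' ltac:(lia) ltac:(lia)) as H1.
assert (H2 : Qabs (gh k (sq x n) n' - gh k (sq x n') n') <= pow2 (- Zpos (p + 1))).
{ apply (gh_cont k c d); [apply Hx | apply Hx |].
  eapply Qle_trans; [apply (sq_cauchy x (Pos.pred (gomega k c d (p + 1)%positive))); lia|].
  apply pow2_le; lia. }
pose proof (Qabs_tri (gh k (sq x n) n) (gh k (sq x n) n') (gh k (sq x n') n')) as H3.
replace (p + 2)%positive with (p + 1 + 1)%positive in H1 by lia.
rewrite !pow2_opp_succ in H1; rewrite pow2_opp_succ in H2.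
pose proof (pow2_pos (- Zpos p)); lra.
Qed.

Lemma real_in_bexp x : real_in (- pow2 (Zpos (bexp x))) (pow2 (Zpos (bexp x))) x.
Proof. intro n; apply Qabs_Qle_condition, bexp_bound. Qed.

(** The value at [x] uses one interval containing [x]; by [gval_indep] below
    any other choice gives an equal real. *)
Definition gval (k : gcont) (x : real) : real :=
  gval_on k (- pow2 (Zpos (bexp x))) (pow2 (Zpos (bexp x))) x (real_in_bexp x).

Lemma req_same_sq x y : (forall n, sq x n = sq y n) -> x =r y.
Proof.
intros H p; rewrite <- H.
apply Qle_trans with (pow2 (- Zpos (p + 1))); [|apply pow2_le; lia].
destruct (Nat.le_ge_cases (md x (p + 1)) (md y (p + 1))) as [Hc|Hc].
- apply sq_cauchy; [apply le_n | exact Hc].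
- rewrite !H; apply sq_cauchy; [exact Hc | apply le_n].
Qed.

Lemma gval_indep k c d x (Hx : real_in c d x) : gval k x =r gval_on k c d x Hx.
Proof. apply req_same_sq; reflexivity. Qed.

(** ** Comparison functions *)

Record classK (k : gcont) : Set := {
  classK_zero : forall x, x =r rzero -> gval k x =r rzero;
  classK_incr : forall x y, rzero <=r x -> rzero <=r y ->
    x <=r y -> gval k x <=r gval k y;
  classK_reflects : forall x y, rzero <=r x -> rzero <=r y ->
    gval k x <=r gval k y -> x <=r y;
  classK_pos : forall x, rzero <r x -> rzero <r gval k x
}.

Record classK_lt (k : gcont) : Set := {
  classK_lt_classK : classK k;
  classK_lt_incr : forall x y, rzero <=r x -> rzero <=r y ->
    x <r y -> gval k x <r gval k y;
  classK_lt_reflects : forall x y, rzero <=r x -> rzero <=r y ->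
    gval k x <r gval k y -> x <r y
}.

(* Main.v *)
Require Import Defs.
From Stdlib Require Import Lqa Lia.

(** Since [k2] is continuous and vanishes at [0], there is a rational [delta > 0]
    with [k2 delta < k1 eps]. If [|x(0)| < delta], then
    [k1 |x(n)| <= V(x(n)) <= V(x(0)) <= k2 |x(0)| < k2 delta < k1 eps],
    and [k1] reflects the strict order. *)

(** Each real is sampled at indices set by its own modulus; passing to all large indices lets
    several comparisons be combined at one common index by linear rational arithmetic. *)
Definition eventually (P : nat -> Prop) : Prop :=
  exists n0 : nat, forall n : nat, (n0 <= n)%nat -> P n.

Lemma eventually_and (P Q : nat -> Prop) :
  eventually P -> eventually Q -> eventually (fun n => P n /\ Q n).
Proof.
intros [n1 H1] [n2 H2]; exists (Nat.max n1 n2); intros n Hn.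
split; [apply H1 | apply H2]; lia.
Qed.

Lemma eventually_impl (P Q : nat -> Prop) :
  (forall n, P n -> Q n) -> eventually P -> eventually Q.
Proof. intros HPQ [n0 H]; exists n0; intros n Hn; apply HPQ, H, Hn. Qed.

Lemma sq_near_md (x : real) (p : positive) :
  eventually (fun n => Qabs (sq x n - sq x (md x p)) <= pow2 (- Zpos p)).
Proof.
exists (md x p); intros n Hn; apply sq_cauchy; [exact Hn | apply le_n].
Qed.

(** The exponent is an explicit argument because [eventually] is a proposition and cannot supply the
    witness in [rlt]. Moving to the sampling index costs at most a quarter of the gap, so [p + 1]
    works. *)
Lemma rlt_of_eventually (x y : real) (p : positive) :
  eventually (fun n => sq x n + pow2 (- Zpos p) <= sq y n) -> x <r y.
Proof.
intro H; exists (p + 1)%positive; unfold rlt_at, rpos_at.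
destruct (eventually_and _ _ H (sq_near_md (rminus y x) (p + 1 + 1))) as [n Hn].
destruct (Hn n (le_n n)) as [H1 H2].
apply Qabs_Qle_condition in H2.
change (sq (rminus y x) n) with (sq y n + - sq x n) in H2.
rewrite !pow2_opp_succ in *; pose proof (pow2_pos (- Zpos p)); lra.
Qed.

Lemma rlt_at_eventually (x y : real) (p : positive) :
  rlt_at p x y ->
  eventually (fun n => sq x n + pow2 (- Zpos (p + 1)) <= sq y n).
Proof.
unfold rlt_at, rpos_at; intro H.
apply (fun h => eventually_impl _ _ h (sq_near_md (rminus y x) (p + 1))).
intros n H1; apply Qabs_Qle_condition in H1.
change (sq (rminus y x) n) with (sq y n + - sq x n) in H1.
rewrite pow2_opp_succ in *; lra.
Qed.

Lemma rle_of_eventually (x y : real) :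
  eventually (fun n => sq x n <= sq y n) -> x <=r y.
Proof.
intros H p.
destruct (eventually_and _ _ H (sq_near_md (rminus y x) p)) as [n Hn].
destruct (Hn n (le_n n)) as [H1 H2].
apply Qabs_Qle_condition in H2.
change (sq (rminus y x) n) with (sq y n + - sq x n) in H2; lra.
Qed.

Lemma rle_eventually (x y : real) (p : positive) :
  x <=r y -> eventually (fun n => sq x n <= sq y n + pow2 (- Zpos p)).
Proof.
intro H; specialize (H (p + 1)%positive).
apply (fun h => eventually_impl _ _ h (sq_near_md (rminus y x) (p + 1))).
intros n H1; apply Qabs_Qle_condition in H1.
change (sq (rminus y x) n) with (sq y n + - sq x n) in H1.
rewrite pow2_opp_succ in *; lra.
Qed.

Lemma req_eventually (x y : real) (p : positive) :
  x =r y -> eventually (fun n => Qabs (sq x n - sq y n) <= pow2 (- Zpos p)).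
Proof.
(* Error budget: half of [pow2 (- Zpos p)] for the equality, a quarter for moving each of [x] and
   [y] to the index [n]. *)
intro H; specialize (H (p + 1)%positive).
apply (fun h => eventually_impl _ _ h
  (eventually_and _ _ (sq_near_md x (p + 1 + 1)) (sq_near_md y (p + 1 + 1)))).
intros n [H1 H2].
apply Qabs_Qle_condition in H, H1, H2; apply Qabs_Qle_condition.
rewrite !pow2_opp_succ in *; lra.
Qed.

Lemma rlt_le (x y : real) : x <r y -> x <=r y.
Proof.
intros [p H]; apply rle_of_eventually.
refine (eventually_impl _ _ _ (rlt_at_eventually _ _ _ H)).
intros n H1; pose proof (pow2_pos (- Zpos (p + 1))); lra.
Qed.

Lemma rle_lt_trans (x y z : real) : x <=r y -> y <r z -> x <r z.
Proof.
(* The strict inequality leaves an eventual gap of [pow2 (- Zpos (p + 1))]; half of it absorbs the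
   slack in [x <=r y]. *)
intros Hxy [p Hyz]; apply (rlt_of_eventually _ _ (p + 1 + 1)).
refine (eventually_impl _ _ _ (eventually_and _ _
  (rle_eventually _ _ (p + 1 + 1) Hxy) (rlt_at_eventually _ _ _ Hyz))).
intros n [H1 H2]; rewrite !pow2_opp_succ in *; lra.
Qed.

Lemma rlt_trans (x y z : real) : x <r y -> y <r z -> x <r z.
Proof. intro H; apply rle_lt_trans, rlt_le, H. Qed.

Lemma rconst_pow2_pos (z : Z) : (z <= 0)%Z -> rzero <r rconst (pow2 z).
Proof.
intro Hz; destruct z as [|p|p]; [|lia|].
(* Exponents of strict inequalities are positive, so the constant 1 is bounded below by 1/2. *)
- apply (rlt_of_eventually _ _ 1); exists 0%nat; intros n _; discriminate.
- apply (rlt_of_eventually _ _ p); exists 0%nat; intros n _; simpl; lra.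
Qed.

Lemma gval_small_near_zero (k : gcont) (e : real) :
  gval k rzero =r rzero -> rzero <r e ->
  {d : real & ((rzero <r d) * (gval k d <r e))%type}.
Proof.
intros Hk [p He].
(* The witness [pow2 (- Zpos w)] lies in [0, 1], within the continuity radius of 0 for precision
   [p + 2]. *)
set (w := gomega k 0 1 (p + 2)).
exists (rconst (pow2 (- Zpos w))); split; [apply rconst_pow2_pos; lia|].
(* This is what remains of the lower bound 2^-(p+1) on [e] after subtracting 2^-(p+2) for continuity
   and 2^-(p+3) for the value at 0. *)
apply (rlt_of_eventually _ _ (p + 1 + 1 + 1)).
refine (eventually_impl _ _ _ (eventually_and _ _
  (req_eventually _ _ (p + 1 + 1 + 1) Hk) (rlt_at_eventually _ _ _ He))).
intros n [H1 H2].
(* The approximations of [gval] do not depend on the interval chosen in its definition, so the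
   modulus on [0, 1] applies to them. *)
change (Qabs (gh k 0 n - 0) <= pow2 (- Zpos (p + 1 + 1 + 1))) in H1.
change (0 + pow2 (- Zpos (p + 1)) <= sq e n) in H2.
change (gh k (pow2 (- Zpos w)) n + pow2 (- Zpos (p + 1 + 1 + 1)) <= sq e n).
pose proof (pow2_pos (- Zpos w)) as Hw.
assert (Hw1 : pow2 (- Zpos w) <= 1) by (apply (pow2_le _ 0); lia).
assert (H3 : Qabs (gh k (pow2 (- Zpos w)) n - gh k 0 n) <= pow2 (- Zpos (p + 2))).
{ apply (gh_cont k 0 1); [split; lra | split; lra |].
  fold w; rewrite Qabs_pos by lra.
  apply Qle_trans with (pow2 (- Zpos w)); [lra | apply pow2_le; lia]. }
apply Qabs_Qle_condition in H1, H3.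
replace (p + 2)%positive with (p + 1 + 1)%positive in H3 by lia.
rewrite !pow2_opp_succ in *; lra.
Qed.

Theorem proposition4p20 :
  forall (m : nat) (Hm : (1 <= m)%nat)
    (N : vec m -> real) (HN : is_norm N)
    (F : vec m -> vec m)
    (HF : forall x y : vec m, x =v y -> F x =v F y)
    (HF0 : F vzero =v vzero)
    (V : vec m -> real) (k1 k2 : gcont)
    (Hk1 : classK_lt k1) (Hk2 : classK_lt k2)
    (HV : forall x : vec m, gval k1 (N x) <=r V x /\ V x <=r gval k2 (N x))
    (Hdecr : forall (x0 : vec m) (x : nat -> vec m),
       is_solution F x0 x -> forall n : nat, V (x (S n)) <=r V (x n)),
  forall eps : real, rzero <r eps ->
    {delta : real &
      ((rzero <r delta) *
       (forall (x0 : vec m) (x : nat -> vec m), is_solution F x0 x ->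
          N (x 0%nat) <r delta -> forall n : nat, N (x n) <r eps))%type}.
Proof.
intros m Hm N HN F HF HF0 V k1 k2 Hk1 Hk2 HV Hdecr eps Heps.
destruct (gval_small_near_zero k2 (gval k1 eps)) as [delta [Hd Hde]].
- apply (classK_zero _ (classK_lt_classK _ Hk2)), req_same_sq; reflexivity.
- exact (classK_pos _ (classK_lt_classK _ Hk1) _ Heps).
- exists delta; split; [exact Hd|].
  intros x0 x Hx Hx0 n.
  apply (classK_lt_reflects _ Hk1); [apply (norm_nonneg _ HN) | apply rlt_le, Heps |].
  (* The induction propagates the bound on [V (x n)], which is nonincreasing; the norm itself may
     grow along a solution. *)
  apply rle_lt_trans with (V (x n)); [apply HV|].
  induction n as [|n IH].
  + apply rle_lt_trans with (gval k2 (N (x 0%nat))); [apply HV|].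
    apply rlt_trans with (gval k2 delta); [|exact Hde].
    apply (classK_lt_incr _ Hk2);
      [apply (norm_nonneg _ HN) | apply rlt_le, Hd | exact Hx0].
  + exact (rle_lt_trans _ _ _ (Hdecr x0 x Hx n) IH).
Qed.
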